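(* Let $A\in\mathrm{End}(\mathbb C^n\otimes\mathbb C^n)$ be an idempotent, $S=1-A$, and $k\ge2$. Consider the subspaces (conditions imposed for all $a=1,\dots,k-1$) $$V_k=\{\pi\in(\mathbb C^n)^{\otimes k}\mid A^{(a,a+1)}\pi=0\},\qquad \overline V_k=\{\xi\in((\mathbb C^n)^{\otimes k})^*\mid \xi A^{(a,a+1)}=0\},$$ $$W_k=\{\pi\in(\mathbb C^n)^{\otimes k}\mid S^{(a,a+1)}\pi=0\},\qquad \overline W_k=\{\xi\in((\mathbb C^n)^{\otimes k})^*\mid \xi S^{(a,a+1)}=0\}.$$ There are isomorphisms $\mathfrak X_A(\mathbb C)_k\cong V_k^*$, $\mathfrak X^*_A(\mathbb C)_k\cong\overline V_k^*$, $\Xi_A(\mathbb C)_k\cong\overline W_k^*$, $\Xi^*_A(\mathbb C)_k\cong W_k^*$ given by the (well-defined) pairings $$\langle\xi(X\otimes\cdots\otimes X),\pi\rangle=\xi\pi,\quad \xi\in((\mathbb C^n)^{\otimes k})^*,\ \pi\in V_k;$$ $$\langle(X^*\otimes\cdots\otimes X^* )\pi,\xi\rangle=\xi\pi,\quad \pi\in(\mathbb C^n)^{\otimes k},\ \xi\in\overline V_k;$$ $$\langle(\Psi\otimes\cdots\otimes\Psi)\pi,\xi\rangle=\xi\pi,\quad \pi\in(\mathbb C^n)^{\otimes k},\ \xi\in\overline W_k;$$ $$\langle\xi(\Psi^*\otimes\cdots\otimes\Psi^* ),\pi\rangle=\xi\pi,\quad \xi\in((\mathbb C^n)^{\otimes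 k})^*,\ \pi\in W_k.$$ Moreover: (1) The $k$-th $S$-operator $S_{(k)}$ for the idempotent $A$ exists if and only if the spaces $V_k$ and $\overline V_k$ are dual via the natural pairing, that is, $\dim V_k=\dim\overline V_k$ and there are bases $(v_\alpha)$ of $V_k$ and $(v^\alpha)$ of $\overline V_k$ such that $v^\alpha v_\beta=\delta^\alpha_\beta$. In this case $S_{(k)}=\sum_\alpha v_\alpha v^\alpha$. (2) The $k$-th $A$-operator $A_{(k)}$ for the idempotent $A$ exists if and only if the spaces $W_k$ and $\overline W_k$ are dual via the natural pairing, that is, $\dim W_k=\dim\overline W_k$ and there are bases $(w_\alpha)$ of $W_k$ and $(w^\alpha)$ of $\overline W_k$ such that $w^\alpha w_\beta=\delta^\alpha_\beta$. In this case $A_{(k)}=\sum_\alpha w_\alpha w^\alpha$.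
   Context: Entries of $A$: $A(e_i\otimes e_j)=\sum_{k,l}A^{kl}_{ij}e_k\otimes e_l$, where $(e_i)$, $(e^i)$ are the standard dual bases of $\mathbb C^n$ (columns) and $(\mathbb C^n)^*$ (rows). For $T\in\mathrm{End}(\mathbb C^n\otimes\mathbb C^n)$, $T^{(a,a+1)}\in\mathrm{End}((\mathbb C^n)^{\otimes k})$ acts as $T$ in the tensor factors $a,a+1$ and identically elsewhere. Operators act on vectors from the left and on covectors from the right; for a vector $v$ and covector $\xi$, $v\xi$ is the rank-one operator $w\mapsto\xi(w)v$. Four graded unital associative algebras over $\mathbb C$ with generators of degree 1 are associated to $A$: $\mathfrak X_A(\mathbb C)$ with generators $x^1,\dots,x^n$ and relations $\sum_{i,j}A^{kl}_{ij}x^ix^j=0$; $\mathfrak X^*_A(\mathbb C)$ with generators $x_1,\dots,x_n$ and relations $\sum_{i,j}x_ix_jA^{ij}_{kl}=0$; $\Xi_A(\mathbb C)$ with generators $\psi_1,\dots,\psi_n$ and relations $\psi_i\psi_j=\sum_{k,l}A^{kl}_{ij}\psi_k\psi_l$; $\Xi^*_A(\mathbb C)$ with generators $\psi^1,\dots,\psi^n$ and relations $\psi^i\psi^j=\sum_{k,l}A^{ij}_{kl}\psi^k\psi^l$. The index $k$ in $\mathfrak X_A(\mathbb C)_k$ etc. denotes the $k$-th graded component. Put $X=\sum_ix^ie_i$, $X^*=\sum_ix_ie^i$, $\Psi=\sum_i\psi_ie^i$, $\Psi^*=\sum_i\psi^ie_i$; with $k$ tensor factors, $X\otimes\cdots\otimes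 X=\sum x^{i_1}\cdots x^{i_k}\,e_{i_1}\otimes\cdots\otimes e_{i_k}$, and similarly for $X^*,\Psi,\Psi^*$. An operator $S_{(k)}\in\mathrm{End}((\mathbb C^n)^{\otimes k})$ is the $k$-th $S$-operator for $A$ if $A^{(a,a+1)}S_{(k)}=S_{(k)}A^{(a,a+1)}=0$ for $a=1,\dots,k-1$, $(X^*\otimes\cdots\otimes X^* )S_{(k)}=X^*\otimes\cdots\otimes X^*$ and $S_{(k)}(X\otimes\cdots\otimes X)=X\otimes\cdots\otimes X$. An operator $A_{(k)}\in\mathrm{End}((\mathbb C^n)^{\otimes k})$ is the $k$-th $A$-operator for $A$ if $S^{(a,a+1)}A_{(k)}=A_{(k)}S^{(a,a+1)}=0$ for $a=1,\dots,k-1$, $(\Psi\otimes\cdots\otimes\Psi)A_{(k)}=\Psi\otimes\cdots\otimes\Psi$ and $A_{(k)}(\Psi^*\otimes\cdots\otimes\Psi^* )=\Psi^*\otimes\cdots\otimes\Psi^*$. *)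

(* Defs.v *)
From HB Require Import structures.
From mathcomp Require Import all_boot all_order all_algebra.
From mathcomp Require Import finmap.
From mathcomp Require Import monalg.
From mathcomp Require Import boolp reals complex.

Set Implicit Arguments.
Unset Strict Implicit.
Unset Printing Implicit Defensive.

Import GRing.Theory Quotient.

Local Open Scope ring_scope.
Local Open Scope quotient_scope.

Notation freeAlg K n := {malg K[{fmonom 'I_n}]}.

Section FreeAlgebra.
Variables (K : fieldType) (n : nat).
Implicit Types (f g : freeAlg K n).

Definition gen (i : 'I_n) : freeAlg K n := << fmu i >>.

Definition homog (d : nat) f : Prop := forall m, m \in msupp f -> fdeg m = d.

Lemma homog0 d : homog d 0.
Proof. by move=> m; rewrite msupp0. Qed.

Lemma homogZ d c f : homog d f -> homog d (c *: f).
Proof.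
by move=> hf m; rewrite msuppZ; case: eqP => // _; exact: hf.
Qed.

Lemma homogD d f g : homog d f -> homog d g -> homog d (f + g).
Proof.
move=> hf hg m /(fsubsetP (msuppD_le _ _)); rewrite in_fsetU.
by case/orP; [exact: hf | exact: hg].
Qed.

Lemma homogB d f g : homog d f -> homog d g -> homog d (f - g).
Proof. by move=> hf hg; rewrite -scaleN1r; apply/homogD/homogZ. Qed.

Lemma homog_sum d (I : Type) (s : seq I) (P : pred I) (F : I -> freeAlg K n) :
  (forall i, P i -> homog d (F i)) -> homog d (\sum_(i <- s | P i) F i).
Proof. by move=> hF; elim/big_rec: _ => [|i f Pi]; [exact: homog0 | exact/homogD/hF]. Qed.

Lemma homogM d e f g : homog d f -> homog e g -> homog (d + e) (f * g).
Proof.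
move=> hf hg m /msuppM_le [m1 [m2 [/hf <- /hg <- ->]]].
by rewrite fdegM.
Qed.

Lemma homog_gen i : homog 1 (gen i).
Proof. by move=> m; rewrite msuppU1 in_fset1 => /eqP ->; rewrite fdegU. Qed.

Lemma homog1 : homog 0 (1 : freeAlg K n).
Proof. by move=> m; rewrite msuppC oner_eq0 in_fset1 => /eqP ->; rewrite fdeg1. Qed.

Lemma homog_prod (s : seq 'I_n) : homog (size s) (\prod_(i <- s) gen i).
Proof.
elim: s => [|i s IHs]; first by rewrite big_nil; exact: homog1.
by rewrite big_cons /= -add1n; apply: homogM IHs; exact: homog_gen.
Qed.

Lemma homog_coef1 d f : homog d.+1 f -> mcoeff (mone : {fmonom 'I_n}) f = 0.
Proof.
move=> hf; apply/eqP; rewrite mcoeff_eq0; apply/negP => /hf.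
by rewrite fdeg1.
Qed.

Lemma freeAlg_scaleAr (c : K) f g : c *: (f * g) = f * (c *: g).
Proof.
have cC h : h * c%:MP = c%:MP * h.
  rewrite mul_malgC malgM_def fgmulgU malgZ_def.
  by apply: eq_bigr => m _; rewrite mulm1 mulrC.
by rewrite -!mul_malgC mulrA -cC mulrA.
Qed.

End FreeAlgebra.

(* Families of homogeneous relations of degree 2; homogeneity guarantees that
   the quotient is a nonzero ring. *)
Record quadRel (K : fieldType) (n : nat) := QuadRel {
  rel :> 'I_n * 'I_n -> freeAlg K n;
  rel_homog : forall p, homog 2 (rel p)
}.

Section QuadraticAlgebra.
Variables (K : fieldType) (n : nat) (r : quadRel K n).
Local Notation F := (freeAlg K n).
Implicit Types (f g h : F).

(* The two-sided ideal generated by the relations. *)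
Definition rel_ideal : {pred F} := fun f =>
  `[< exists s : seq (F * ('I_n * 'I_n) * F),
        f = \sum_(t <- s) t.1.1 * r t.1.2 * t.2 >].

Lemma rel_idealP f :
  reflect (exists s : seq (F * ('I_n * 'I_n) * F),
             f = \sum_(t <- s) t.1.1 * r t.1.2 * t.2) (f \in rel_ideal).
Proof. exact: asboolP. Qed.

Lemma rel_ideal_zmod_closed : zmod_closed rel_ideal.
Proof.
split=> [|f g /rel_idealP [s ->] /rel_idealP [s' ->]]; apply/rel_idealP.
  by exists [::]; rewrite big_nil.
exists (s ++ [seq (- t.1.1, t.1.2, t.2) | t <- s']).
rewrite big_cat big_map /= -sumrN; congr (_ + _).
by apply: eq_bigr => t _; rewrite !mulNr.
Qed.

HB.instance Definition _ :=
  GRing.isZmodClosed.Build F rel_ideal rel_ideal_zmod_closed.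

Lemma rel_idealMl f g : g \in rel_ideal -> f * g \in rel_ideal.
Proof.
move=> /rel_idealP [s ->]; apply/rel_idealP.
exists [seq (f * t.1.1, t.1.2, t.2) | t <- s].
by rewrite big_map mulr_sumr; apply: eq_bigr => t _; rewrite !mulrA.
Qed.

Lemma rel_idealMr f g : g \in rel_ideal -> g * f \in rel_ideal.
Proof.
move=> /rel_idealP [s ->]; apply/rel_idealP.
exists [seq (t.1.1, t.1.2, t.2 * f) | t <- s].
by rewrite big_map mulr_suml; apply: eq_bigr => t _; rewrite !mulrA.
Qed.

Lemma rel_idealZ c f : f \in rel_ideal -> c *: f \in rel_ideal.
Proof. by rewrite -mul_malgC; exact: rel_idealMl. Qed.

Lemma rel_ideal1 : 1 \notin rel_ideal.
Proof.
apply/negP => /rel_idealP [s /(congr1 (mcoeff (mone : {fmonom 'I_n})))].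
rewrite rmorph1 raddf_sum big1 => [/eqP|t _]; first by rewrite oner_eq0.
by rewrite /= !rmorphM /= (homog_coef1 (@rel_homog _ _ r _)) mulr0 mul0r.
Qed.

Definition quadAlg : Type := quot rel_ideal.
HB.instance Definition _ := GRing.Zmodule.on quadAlg.
HB.instance Definition _ := EqQuotient.on quadAlg.

Lemma quadAlg_eqP f g : reflect (f = g %[mod quadAlg]) (f - g \in rel_ideal).
Proof. by rewrite idealrBE; exact: eqP. Qed.

Lemma quadAlgW (P : quadAlg -> Prop) :
  (forall f, P (\pi_quadAlg f)) -> forall x, P x.
Proof. by move=> Ppi x; rewrite -[x]reprK. Qed.

Definition qone : quadAlg := \pi_quadAlg 1.
Definition qmul (x y : quadAlg) : quadAlg := \pi_quadAlg (repr x * repr y).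
Definition qscale (c : K) (x : quadAlg) : quadAlg := \pi_quadAlg (c *: repr x).

Lemma piD f g : \pi_quadAlg (f + g) = \pi_quadAlg f + \pi_quadAlg g.
Proof. by rewrite -pi_addr. Qed.

Lemma piM f g : \pi_quadAlg (f * g) = qmul (\pi_quadAlg f) (\pi_quadAlg g).
Proof.
apply/quadAlg_eqP; set f' := repr _; set g' := repr _.
have -> : f * g - f' * g' = (f - f') * g + f' * (g - g').
  by rewrite mulrBl mulrBr addrA subrK.
by apply: rpredD; [apply: rel_idealMr | apply: rel_idealMl];
   apply/quadAlg_eqP; rewrite reprK.
Qed.

Lemma piZ c f : \pi_quadAlg (c *: f) = qscale c (\pi_quadAlg f).
Proof.
apply/quadAlg_eqP; rewrite -scalerBr rel_idealZ //.
by apply/quadAlg_eqP; rewrite reprK.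
Qed.

Lemma qmulA : associative qmul.
Proof.
by move=> x y z; elim/quadAlgW: x => f; elim/quadAlgW: y => g; elim/quadAlgW: z => h;
   rewrite -!piM mulrA.
Qed.

Lemma qmul1q : left_id qone qmul.
Proof. by move=> x; elim/quadAlgW: x => f; rewrite -piM mul1r. Qed.

Lemma qmulq1 : right_id qone qmul.
Proof. by move=> x; elim/quadAlgW: x => f; rewrite -piM mulr1. Qed.

Lemma qmulDl : left_distributive qmul +%R.
Proof.
by move=> x y z; elim/quadAlgW: x => f; elim/quadAlgW: y => g; elim/quadAlgW: z => h;
   rewrite -!(piM, piD) mulrDl.
Qed.

Lemma qmulDr : right_distributive qmul +%R.
Proof.
by move=> x y z; elim/quadAlgW: x => f; elim/quadAlgW: y => g; elim/quadAlgW: z => h;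
   rewrite -!(piM, piD) mulrDr.
Qed.

Lemma qone_neq0 : qone != 0.
Proof.
apply/negP => /eqP; rewrite -[0](@pi_zeror _ _ _ _ _ quadAlg).
by move=> /quadAlg_eqP; rewrite subr0 (negPf rel_ideal1).
Qed.

HB.instance Definition _ := GRing.Zmodule_isNzRing.Build quadAlg
  qmulA qmul1q qmulq1 qmulDl qmulDr qone_neq0.

Lemma qscaleA a b x : qscale a (qscale b x) = qscale (a * b) x.
Proof. by elim/quadAlgW: x => f; rewrite -!piZ scalerA. Qed.

Lemma qscale1 : left_id 1 qscale.
Proof. by move=> x; elim/quadAlgW: x => f; rewrite -piZ scale1r. Qed.

Lemma qscaleDr : right_distributive qscale +%R.
Proof.
by move=> a x y; elim/quadAlgW: x => f; elim/quadAlgW: y => g; rewrite -!(piZ, piD) scalerDr.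
Qed.

Lemma qscaleDl x : {morph qscale^~ x : a b / a + b}.
Proof. by elim/quadAlgW: x => f a b; rewrite -!(piZ, piD) scalerDl. Qed.

HB.instance Definition _ := GRing.Zmodule_isLmodule.Build K quadAlg
  qscaleA qscale1 qscaleDr qscaleDl.

Lemma piMr f g : \pi_quadAlg (f * g) = \pi_quadAlg f * \pi_quadAlg g.
Proof. exact: piM. Qed.

Lemma piZr c f : \pi_quadAlg (c *: f) = c *: \pi_quadAlg f.
Proof. exact: piZ. Qed.

Lemma qscaleAl (a : K) (x y : quadAlg) : a *: (x * y) = (a *: x) * y.
Proof.
elim/quadAlgW: x => f; elim/quadAlgW: y => g.
by rewrite -(piMr f g) -(piZr a (f * g)) -(piZr a f) -(piMr _ g) scalerAl.
Qed.

HB.instance Definition _ := GRing.Lmodule_isLalgebra.Build K quadAlg qscaleAl.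

Lemma qscaleAr (a : K) (x y : quadAlg) : a *: (x * y) = x * (a *: y).
Proof.
elim/quadAlgW: x => f; elim/quadAlgW: y => g.
by rewrite -(piMr f g) -(piZr a (f * g)) -(piZr a g) -(piMr f) freeAlg_scaleAr.
Qed.

HB.instance Definition _ := GRing.Lalgebra_isAlgebra.Build K quadAlg qscaleAr.

Definition qgen (i : 'I_n) : quadAlg := \pi_quadAlg (gen K i).

(* The k-th graded component: the image of the homogeneous elements of
   degree k of the free algebra. *)
Definition in_grade (k : nat) : {pred quadAlg} := fun x =>
  `[< exists2 f, homog k f & x = \pi_quadAlg f >].

Lemma in_gradeP k x :
  reflect (exists2 f, homog k f & x = \pi_quadAlg f) (x \in in_grade k).
Proof. exact: asboolP. Qed.

Lemma in_grade_submod_closed k : submod_closed (in_grade k).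
Proof.
split=> [|c x y /in_gradeP [f hf ->] /in_gradeP [g hg ->]]; apply/in_gradeP.
  by exists 0; [exact: homog0 | rewrite pi_zeror].
exists (c *: f + g); first by apply: homogD => //; exact: homogZ.
by rewrite piD piZr.
Qed.

HB.instance Definition _ k :=
  GRing.isSubmodClosed.Build K quadAlg (in_grade k) (in_grade_submod_closed k).

Record grade (k : nat) : Type := Grade {
  grade_val :> quadAlg;
  gradeP : grade_val \in in_grade k
}.

HB.instance Definition _ k := [isSub for @grade_val k].
HB.instance Definition _ k := [Choice of grade k by <:].
HB.instance Definition _ k := [SubChoice_isSubLmodule of grade k by <:].

Section Monomials.
Variable k : nat.

Lemma in_grade_monomial (I : {ffun 'I_k -> 'I_n}) :
  \prod_(a < k) qgen (I a) \in in_grade k.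
Proof.
apply/in_gradeP; exists (\prod_(i <- codom I) gen K i).
  by have := @homog_prod K n (codom I); rewrite size_codom card_ord.
have enumE : index_enum 'I_k = enum 'I_k by rewrite enumT [index_enum _]unlock.
rewrite -[codom I]/[seq I a | a <- enum 'I_k] big_map -enumE.
apply/esym; apply: (big_morph (fun f => \pi_quadAlg f) _ (erefl _)).
exact: piM.
Qed.

(* The tensor X (x) ... (x) X with k factors, given by its components
   x^{i_1} ... x^{i_k}; the products are ordered. *)
Definition xpow : {ffun {ffun 'I_k -> 'I_n} -> grade k} :=
  [ffun I => Grade (in_grade_monomial I)].

End Monomials.

End QuadraticAlgebra.

Notation mindex n k := {ffun 'I_k -> 'I_n}.
Notation tensor K n k := {ffun mindex n k -> K^o}.
Notation covector K n k := 'Hom(tensor K n k, K^o).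
(* C^n (x) C^n, with basis indexed by pairs; (a, b) stands for e_a (x) e_b *)
Notation tensor2 K n := {ffun 'I_n * 'I_n -> K^o}.

Section Operators.
Variables (K : fieldType).

Section Coordinates.
Variables (I : finType).

Definition ebasis (i : I) : {ffun I -> K^o} := [ffun j => (j == i)%:R].

(* The matrix entry T^i_j: the coefficient of e_i in T(e_j). *)
Definition entry (T : 'End({ffun I -> K^o})) (i j : I) : K := T (ebasis j) i.

(* Tensors with components in a space M; operators act on vectors (lact) from
   the left and on covectors (ract) from the right. *)
Variable M : lmodType K.
Implicit Types (T : 'End({ffun I -> K^o})) (u : {ffun I -> M}).

Definition lact T u : {ffun I -> M} := [ffun i => \sum_j entry T i j *: u j].

Definition ract u T : {ffun I -> M} := [ffun j => \sum_i entry T i j *: u i].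

Definition covec_app (xi : 'Hom({ffun I -> K^o}, K^o)) u : M :=
  \sum_i (xi (ebasis i) : K) *: u i.

Definition vec_app u (v : {ffun I -> K^o}) : M := \sum_i (v i : K) *: u i.

End Coordinates.

Definition rank1 (U : vectType K) (v : U) (xi : 'Hom(U, K^o)) : 'End(U) :=
  linfun (fun w => (xi w : K) *: v).

Lemma rank1E (U : vectType K) (v : U) (xi : 'Hom(U, K^o)) w :
  rank1 v xi w = (xi w : K) *: v.
Proof.
pose f w := (xi w : K) *: v.
have f_linear : linear f by move=> c x y; rewrite /f linearP scalerDl scalerA.
pose fL := GRing.isLinear.Build K U U *:%R f f_linear.
pose fl : {linear U -> U} := HB.pack f fL.
exact: (lfunE fl).
Qed.

Variables (n k : nat).
Implicit Types (T : 'End(tensor2 K n)) (a : 'I_k.-1) (I : mindex n k).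

Definition lpos a : 'I_k := widen_ord (leq_pred k) a.

Lemma rpos_subproof a : (a.+1 < k)%N.
Proof. by rewrite -ltn_predRL. Qed.

Definition rpos a : 'I_k := Ordinal (rpos_subproof a).

(* I with its entries at positions a, a+1 replaced by p.1, p.2 *)
Definition upd2 a (p : 'I_n * 'I_n) I : mindex n k :=
  [ffun c => if c == lpos a then p.1 else if c == rpos a then p.2 else I c].

Definition leg_fun T a (u : tensor K n k) : tensor K n k :=
  [ffun I : mindex n k =>
     \sum_p entry T (I (lpos a), I (rpos a)) p *: u (upd2 a p I)].

Lemma leg_fun_linear T a : linear (leg_fun T a).
Proof.
move=> c u v; apply/ffunP=> I; rewrite !ffunE scaler_sumr -big_split /=.
apply: eq_bigr => p _; rewrite !ffunE scalerDr !scalerA.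
by rewrite [c * _]mulrC.
Qed.

HB.instance Definition _ T a :=
  GRing.isLinear.Build K (tensor K n k) (tensor K n k) *:%R (leg_fun T a)
    (leg_fun_linear T a).

(* T^{(a,a+1)}; positions are counted from 0, so a ranges over 0, ..., k-2. *)
Definition leg T a : 'End(tensor K n k) := linfun (leg_fun T a).

Definition precomp (f : 'End(tensor K n k)) (xi : covector K n k) :
  covector K n k := (xi \o f)%VF.

Lemma precomp_linear f : linear (precomp f).
Proof. by move=> c x y; rewrite /precomp comp_lfunDl comp_lfunZl. Qed.

HB.instance Definition _ f :=
  GRing.isLinear.Build K (covector K n k) (covector K n k) *:%R (precomp f)
    (precomp_linear f).

Definition ker_legs T : {vspace tensor K n k} :=
  (\bigcap_(a < k.-1) lker (leg T a))%VS.

Definition coker_legs T : {vspace covector K n k} :=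
  (\bigcap_(a < k.-1) lker (linfun (precomp (leg T a))))%VS.

Lemma mem_ker_legs T u : u \in ker_legs T <-> forall a, leg T a u = 0.
Proof.
rewrite memvE; split=> [/subv_bigcapP h a | h].
  by have := h a isT; rewrite -memvE memv_ker => /eqP.
by apply/subv_bigcapP => a _; rewrite -memvE memv_ker h.
Qed.

Lemma mem_coker_legs T xi :
  xi \in coker_legs T <-> forall a, (xi \o leg T a)%VF = 0.
Proof.
rewrite memvE; split=> [/subv_bigcapP h a | h].
  by have := h a isT; rewrite -memvE memv_ker lfunE => /eqP.
by apply/subv_bigcapP => a _; rewrite -memvE memv_ker lfunE /= /precomp h.
Qed.

Definition dual_bases (V : {vspace tensor K n k}) (V' : {vspace covector K n k})
    (d : nat) (v : d.-tuple (tensor K n k)) (v' : d.-tuple (covector K n k)) :=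
  [/\ basis_of V v, basis_of V' v' &
      forall al be : 'I_d, tnth v' al (tnth v be) = (al == be)%:R].

Definition naturally_dual (V : {vspace tensor K n k})
    (V' : {vspace covector K n k}) : Prop :=
  \dim V = \dim V' /\
  exists d (v : d.-tuple (tensor K n k)) (v' : d.-tuple (covector K n k)),
    dual_bases V V' v v'.

End Operators.

Section Algebras.
Variables (K : fieldType) (n : nat) (A : 'End(tensor2 K n)).
Local Notation F := (freeAlg K n).
Local Notation x := (gen K).

Lemma homog_gen2 (i j : 'I_n) : homog 2 (x i * x j).
Proof. by rewrite -[2%N]/(1 + 1)%N; apply: homogM; exact: homog_gen. Qed.

(* The four families of relations, indexed by the free pair of indices.  The
   generators x^i, x_i, psi_i, psi^i are all the i-th generator of the free
   algebra; the index position only records which relations are imposed. *)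
Definition X_rel_fun (p : 'I_n * 'I_n) : F :=
  \sum_(q : 'I_n * 'I_n) entry A p q *: (x q.1 * x q.2).
Lemma X_rel_homog p : homog 2 (X_rel_fun p).
Proof. by apply: homog_sum => q _; apply/homogZ/homog_gen2. Qed.
Definition X_rel := QuadRel X_rel_homog.

Definition Xs_rel_fun (p : 'I_n * 'I_n) : F :=
  \sum_(q : 'I_n * 'I_n) entry A q p *: (x q.1 * x q.2).
Lemma Xs_rel_homog p : homog 2 (Xs_rel_fun p).
Proof. by apply: homog_sum => q _; apply/homogZ/homog_gen2. Qed.
Definition Xs_rel := QuadRel Xs_rel_homog.

Definition Psi_rel_fun (p : 'I_n * 'I_n) : F :=
  x p.1 * x p.2 - \sum_(q : 'I_n * 'I_n) entry A q p *: (x q.1 * x q.2).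
Lemma Psi_rel_homog p : homog 2 (Psi_rel_fun p).
Proof. by apply: homogB; [exact: homog_gen2 | exact: Xs_rel_homog]. Qed.
Definition Psi_rel := QuadRel Psi_rel_homog.

Definition Psis_rel_fun (p : 'I_n * 'I_n) : F :=
  x p.1 * x p.2 - \sum_(q : 'I_n * 'I_n) entry A p q *: (x q.1 * x q.2).
Lemma Psis_rel_homog p : homog 2 (Psis_rel_fun p).
Proof. by apply: homogB; [exact: homog_gen2 | exact: X_rel_homog]. Qed.
Definition Psis_rel := QuadRel Psis_rel_homog.

Variable k : nat.

Definition Xpow := xpow X_rel k.
Definition Xspow := xpow Xs_rel k.
Definition Psipow := xpow Psi_rel k.
Definition Psispow := xpow Psis_rel k.

Local Notation S := (\1 - A)%VF.

Definition Vsp := ker_legs k A.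
Definition Vbarsp := coker_legs k A.
Definition Wsp := ker_legs k S.
Definition Wbarsp := coker_legs k S.

Definition is_S_operator (Sk : 'End(tensor K n k)) : Prop :=
  [/\ forall a : 'I_k.-1, (leg A a \o Sk)%VF = 0 /\ (Sk \o leg A a)%VF = 0,
      ract Xspow Sk = Xspow &
      lact Sk Xpow = Xpow].

Definition is_A_operator (Ak : 'End(tensor K n k)) : Prop :=
  [/\ forall a : 'I_k.-1, (leg S a \o Ak)%VF = 0 /\ (Ak \o leg S a)%VF = 0,
      ract Psipow Ak = Psipow &
      lact Ak Psispow = Psispow].

End Algebras.

(* Main.v *)
(** The degree-k part of the free algebra is spanned by words, and that of the
    ideal of relations by words with a relation inserted at two adjacent places.
    A linear form u on words therefore descends to the k-th graded component iff
    its values satisfy the relations at each pair of adjacent places, which says that u lies in V_k (resp. in the other three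
    spaces); finite-dimensional duality gives the four isomorphisms.  Through
    them S (X ... X) = X ... X means that S is the identity on V_k, and
    (X* ... X* ) S = X* ... X* that it is the identity on covectors of
    \bar V_k.  With A S = S A = 0 this makes S the projector onto V_k along the
    annihilator of \bar V_k, and such a projector exists iff V_k and \bar V_k are
    in natural duality.  The case of W_k is the same with 1 - A in place of A. *)

Require Import Defs.
From HB Require Import structures.
From mathcomp Require Import all_boot all_order all_algebra.
From mathcomp Require Import finmap monalg boolp reals complex.

Set Implicit Arguments.
Unset Strict Implicit.
Unset Printing Implicit Defensive.

Import GRing.Theory.

Local Open Scope ring_scope.
Local Open Scope quotient_scope.

(** * Coordinates of vectors, operators and covectors in the standard basis *)

Section Coordinates.
Variables (K : fieldType).

Lemma ebasis_sum (I : finType) (v : {ffun I -> K^o}) :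
  v = \sum_i (v i : K) *: ebasis K i.
Proof.
apply/ffunP => j; rewrite sum_ffunE (bigD1 j) //= !ffunE eqxx.
rewrite big1 => [|i neij]; first by rewrite addr0 [_ *: _]mulr1.
by rewrite !ffunE eq_sym (negPf neij) scaler0.
Qed.

Lemma end_entryE (I : finType) (T : 'End({ffun I -> K^o})) v i :
  T v i = \sum_j entry T i j * v j.
Proof.
rewrite {1}[v]ebasis_sum linear_sum sum_ffunE; apply: eq_bigr => j _.
by rewrite linearZ ffunE mulrC.
Qed.

Lemma covectorE (I : finType) (xi : 'Hom({ffun I -> K^o}, K^o)) v :
  xi v = \sum_i (xi (ebasis K i) : K) * v i.
Proof.
rewrite {1}[v]ebasis_sum linear_sum; apply: eq_bigr => i _.
by rewrite linearZ /= mulrC.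
Qed.

Lemma covector_of_coords (I : finType) (u : I -> K) :
  exists xi : 'Hom({ffun I -> K^o}, K^o), forall i, xi (ebasis K i) = u i.
Proof.
pose pair_fun (v : {ffun I -> K^o}) : K^o := \sum_i u i * v i.
have pair_linear : linear pair_fun.
  move=> a v w; rewrite /pair_fun scaler_sumr -big_split; apply: eq_bigr => i _ /=.
  by rewrite !ffunE mulrDr mulrCA.
pose pairL : {linear {ffun I -> K^o} -> K^o} :=
  HB.pack pair_fun (GRing.isLinear.Build K _ _ *:%R pair_fun pair_linear).
exists (linfun pair_fun) => i.
rewrite [LHS](lfunE pairL) /= /pair_fun (bigD1 i) //= ffunE eqxx mulr1.
by rewrite big1 ?addr0 // => j neji; rewrite ffunE (negPf neji) mulr0.
Qed.

End Coordinates.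

(* {malg K[M]} has an algType structure only for commutative monomials M, whence
   the hypothesis below. *)
Section LinearCombinationProducts.
Variables (K : comNzRingType) (B : lalgType K).
Hypothesis scale_mulr : forall (a : K) (x y : B), a *: (x * y) = x * (a *: y).

Lemma mulr_linsum_mid (I : Type) (s : seq I) (a : I -> K) (x : I -> B) (y z : B) :
  y * (\sum_(i <- s) a i *: x i) * z = \sum_(i <- s) a i *: (y * x i * z).
Proof.
by rewrite mulr_sumr mulr_suml; apply: eq_bigr => i _; rewrite -scale_mulr -scalerAl.
Qed.

Lemma mulr_linsum_sides (I J : Type) (s : seq I) (t : seq J)
    (a : I -> K) (b : J -> K) (x : I -> B) (z : J -> B) (y : B) :
  (\sum_(i <- s) a i *: x i) * y * (\sum_(j <- t) b j *: z j) =
  \sum_(i <- s) \sum_(j <- t) (a i * b j) *: (x i * y * z j).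
Proof.
rewrite !mulr_suml; apply: eq_bigr => i _; rewrite mulr_sumr.
by apply: eq_bigr => j _; rewrite -scale_mulr -!scalerAl scalerA [b j * _]mulrC.
Qed.

End LinearCombinationProducts.

(** * Words as a basis of the free algebra, and forms on words of length [k] *)

Section Words.
Variables (K : fieldType) (n : nat).

Definition word (s : seq 'I_n) : freeAlg K n := \prod_(i <- s) gen K i.

Lemma wordE s : word s = << FMonom s >>.
Proof.
rewrite /word; elim: s => [|i s IHs].
  by rewrite big_nil; congr (<< _ >>); apply/eqP; rewrite fmP fm1.
rewrite big_cons IHs /gen malgM_def fgmulUU mulr1.
by congr (<< _ >>); apply/eqP; rewrite fmP fmM fmU.
Qed.

Lemma word_cat s t : word (s ++ t) = word s * word t.
Proof. exact: big_cat. Qed.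

Lemma freeAlgE (f : freeAlg K n) : f = \sum_(m <- msupp f) f@_m *: word m.
Proof.
rewrite {1}[f]monalgE; apply: eq_bigr => m _.
by rewrite wordE fmK -mul_malgC malgM_def fgmulUU mulr1 mul1m.
Qed.

Variable k : nat.

Lemma size_codom_ord (I : mindex n k) : size (codom I) = k.
Proof. by rewrite size_codom card_ord. Qed.

Lemma nth_codom_ord x0 (I : mindex n k) (c : 'I_k) : nth x0 (codom I) c = I c.
Proof. by rewrite (nth_map c) ?size_enum_ord // nth_ord_enum. Qed.

Lemma codom_ord_inj : injective (fun I : mindex n k => codom I).
Proof.
move=> I J /= eIJ; apply/ffunP => c.
by rewrite -(nth_codom_ord (I c) I) eIJ nth_codom_ord.
Qed.

Lemma codom_tnth (t : k.-tuple 'I_n) : codom [ffun c => tnth t c] = t.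
Proof.
by rewrite -[RHS](map_tnth_enum t); apply: eq_map => c; rewrite ffunE.
Qed.

(** This is the dictionary between the two sides of the theorem: changing two adjacent tensor
    indices is the same as inserting a two-letter word between a prefix and a suffix, which is how
    relations enter the ideal. *)
Lemma codom_upd2 a q (I : mindex n k) :
  codom (upd2 a q I) = take a (codom I) ++ [:: q.1; q.2] ++ drop a.+2 (codom I).
Proof.
have lt_ak := rpos_subproof a.
have sza : size (take a (codom I)) = a.
  by rewrite size_takel // size_codom_ord ltnW // ltnW.
have eq_size : size (codom (upd2 a q I)) =
    size (take a (codom I) ++ [:: q.1; q.2] ++ drop a.+2 (codom I)).
  by rewrite !size_cat sza size_drop !size_codom_ord /= addnA addn2 subnKC.
apply: (@eq_from_nth _ q.1) => // i.
rewrite size_codom_ord => ltik.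
rewrite (nth_codom_ord q.1 _ (Ordinal ltik)) ffunE -!val_eqE /= nth_cat sza.
case: ltngtP => [ltia|gtia|->] /=.
- by rewrite (ltn_eqF (leqW ltia)) nth_take // (nth_codom_ord q.1 _ (Ordinal ltik)).
(* The successor form lets [nth] step over the letter [q.1]; the same is done below for [q.2]. *)
- rewrite (_ : (i - a = (i - a.+1).+1)%N); last by rewrite subnS prednK // subn_gt0.
  rewrite /=; case: (ltngtP i a.+1) => [|gti|->]; last by rewrite subnn.
    by rewrite ltnS leqNgt gtia.
  rewrite (_ : (i - a.+1 = (i - a.+2).+1)%N); last first.
    by rewrite [in RHS]subnS prednK // subn_gt0.
  by rewrite /= nth_drop subnKC // (nth_codom_ord q.1 _ (Ordinal ltik)).
- by rewrite subnn.
Qed.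

(** The form [u] on words of length [k], extended by zero to all other words. It must be defined on
    the whole free algebra because elements of the ideal need not be homogeneous. *)
Definition pair_words (u : mindex n k -> K) (g : freeAlg K n) : K :=
  \sum_I u I * g@_(FMonom (codom I)).

Lemma pair_wordsZ u a g : pair_words u (a *: g) = a * pair_words u g.
Proof.
by rewrite /pair_words mulr_sumr; apply: eq_bigr => I _; rewrite mcoeffZ mulrCA.
Qed.

Lemma pair_words_sum u (I : Type) (s : seq I) (F : I -> freeAlg K n) :
  pair_words u (\sum_(i <- s) F i) = \sum_(i <- s) pair_words u (F i).
Proof.
rewrite /pair_words exchange_big; apply: eq_bigr => J _.
by rewrite raddf_sum mulr_sumr.
Qed.

Lemma pair_words_codom u (I : mindex n k) : pair_words u (word (codom I)) = u I.
Proof.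
rewrite /pair_words (bigD1 I) //= wordE mcoeffUU mulr1 big1 ?addr0 // => J neJI.
rewrite mcoeffU -(inj_eq val_inj) /= (inj_eq codom_ord_inj) eq_sym.
by rewrite (negPf neJI) mulr0.
Qed.

Lemma pair_words_size u s : size s != k -> pair_words u (word s) = 0.
Proof.
move=> sz; apply: big1 => I _; rewrite wordE mcoeffU -(inj_eq val_inj) /=.
by case: eqP => [eIs|_]; [rewrite eIs size_codom_ord eqxx in sz | rewrite mulr0].
Qed.

Lemma homog_wordE f : homog k f ->
  f = \sum_(I : mindex n k) f@_(FMonom (codom I)) *: word (codom I).
Proof.
move=> hf; apply/malgP => m; rewrite raddf_sum /=.
have coefE (I : mindex n k) :
    (f@_(FMonom (codom I)) *: word (codom I))@_m =
    f@_(FMonom (codom I)) *+ (codom I == m :> seq _).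
  by rewrite mcoeffZ wordE mcoeffU1 -(inj_eq val_inj) mulr_natr.
have [/eqP szm|szm] := eqVneq (size m) k; last first.
  rewrite big1 => [|I _]; first by apply/mcoeff_outdom/negP => /hf /(elimN eqP szm).
  by rewrite coefE; case: eqP => // eIm; rewrite -eIm size_codom_ord eqxx in szm.
pose J := [ffun c => tnth (Tuple szm) c].
have codomJ : codom J = m by exact: codom_tnth.
rewrite (bigD1 J) //= (coefE J) codomJ eqxx fmK big1 ?addr0 // => I neIJ.
by rewrite coefE -codomJ (inj_eq codom_ord_inj) (negPf neIJ).
Qed.

End Words.

(** * Graded components of a quadratic algebra with relation coefficients [c] *)

Section Presentation.
Variables (K : fieldType) (n k : nat) (r : quadRel K n).
Variable c : 'I_n * 'I_n -> 'I_n * 'I_n -> K.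
Hypothesis rE : forall p, r p = \sum_q c p q *: (gen K q.1 * gen K q.2).

(** The index [J] supplies the letters around the inserted relation; its own entries at the two
    places of [a] are overwritten, so they do not matter. *)
Definition satisfies_rel (u : mindex n k -> K) : Prop :=
  forall a p J, \sum_q c p q * u (upd2 a q J) = 0.

Lemma word_relE s t p :
  word K s * r p * word K t =
  \sum_q c p q *: word K (s ++ [:: q.1; q.2] ++ t).
Proof.
rewrite rE (mulr_linsum_mid (@freeAlg_scaleAr K n)); apply: eq_bigr => q _.
by rewrite !word_cat mulrA [word K [:: _; _]]big_cons big_seq1.
Qed.

(** By bilinearity it suffices to treat a relation between two words. If the total length is not
    [k], every term pairs to zero; otherwise the value is one of the sums that [satisfies_rel] makes
    vanish. *)
Lemma pair_words_ideal u f :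
  satisfies_rel u -> f \in rel_ideal r -> pair_words u f = 0.
Proof.
move=> hu /rel_idealP [s ->]; rewrite pair_words_sum big1 // => -[[f1 p] f2] _ /=.
have -> : f1 * r p * f2 =
    \sum_(m1 <- msupp f1) \sum_(m2 <- msupp f2)
      (f1@_m1 * f2@_m2) *: (word K m1 * r p * word K m2).
  by rewrite -(mulr_linsum_sides (@freeAlg_scaleAr K n)) -!freeAlgE.
rewrite pair_words_sum big1 // => m1 _; rewrite pair_words_sum big1 // => m2 _.
rewrite pair_wordsZ word_relE pair_words_sum.
have size_mid (q : 'I_n * 'I_n) :
    size (m1 ++ [:: q.1; q.2] ++ m2) = ((size m1).+2 + size m2)%N.
  by rewrite !size_cat /= addnCA addnA.
have [szk|szk] := eqVneq ((size m1).+2 + size m2)%N k; last first.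
  rewrite big1 ?mulr0 // => q _.
  by rewrite pair_wordsZ pair_words_size ?mulr0 // size_mid.
have lt_a : (size m1 < k.-1)%N by rewrite -szk leq_addr.
(* The relation starts right after the letters of [m1]. *)
pose a := Ordinal lt_a.
have szp : size (m1 ++ [:: p.1; p.2] ++ m2) == k by rewrite size_mid szk.
(* The pair [p] only fills the two places that [upd2 a q] overwrites. *)
pose J := [ffun d => tnth (Tuple szp) d].
have codomJ q : m1 ++ [:: q.1; q.2] ++ m2 = codom (upd2 a q J).
  rewrite codom_upd2 codom_tnth /= take_size_cat // -[(size m1).+2]add2n.
  by rewrite -drop_drop drop_size_cat //= drop0.
rewrite [X in _ * X](_ : _ = 0) ?mulr0 // -[RHS](hu a p J).
by apply: eq_bigr => q _; rewrite pair_wordsZ codomJ pair_words_codom.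
Qed.

Lemma pi_sum (I : Type) (s : seq I) (F : I -> freeAlg K n) :
  \pi_(quadAlg r) (\sum_(i <- s) F i) = \sum_(i <- s) \pi_(quadAlg r) (F i).
Proof. by apply: big_morph; [exact: piD | exact: pi_zeror]. Qed.

Lemma grade_val_linsum (I : Type) (s : seq I) (f : I -> K) (x : I -> grade r k) :
  grade_val (\sum_(i <- s) f i *: x i) = \sum_(i <- s) f i *: grade_val (x i).
Proof. exact: (big_morph (@grade_val _ _ r k)). Qed.

Lemma grade_val_xpow (I : mindex n k) :
  grade_val (xpow r k I) = \pi_(quadAlg r) (word K (codom I)).
Proof.
rewrite ffunE /= /word.
have enumE : index_enum 'I_k = enum 'I_k by rewrite enumT [index_enum _]unlock.
rewrite -[codom I]/[seq I a | a <- enum 'I_k] big_map -enumE.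
apply/esym; apply: (big_morph (fun f => \pi_(quadAlg r) f) _ (erefl _)).
exact: piM.
Qed.

Lemma grade_val_xpow_sum (f : mindex n k -> K) :
  grade_val (\sum_I f I *: xpow r k I) =
  \pi_(quadAlg r) (\sum_I f I *: word K (codom I)).
Proof.
rewrite pi_sum grade_val_linsum.
by apply: eq_bigr => I _; rewrite piZr -grade_val_xpow.
Qed.

Lemma xpow_span (x : grade r k) : exists f, x = \sum_I f I *: xpow r k I.
Proof.
case: (x) => y hy; have /in_gradeP [g hg yE] := hy.
exists (fun I : mindex n k => g@_(FMonom (codom I))); apply: val_inj.
by rewrite [RHS]grade_val_xpow_sum -homog_wordE.
Qed.

(** Well-definedness of the pairing: a combination that vanishes in the algebra lifts to an element
    of the ideal, and [u] kills the ideal. *)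
Lemma pairing_eq0 f u : \sum_I f I *: xpow r k I = 0 -> satisfies_rel u ->
  \sum_I f I * u I = 0.
Proof.
move=> f0 hu; have /quadAlg_eqP : \pi_(quadAlg r) (\sum_I f I *: word K (codom I))
  = \pi_(quadAlg r) 0 by rewrite -grade_val_xpow_sum f0 pi_zeror.
rewrite subr0 => /(pair_words_ideal hu) uf0; rewrite -[RHS]uf0 pair_words_sum.
by apply: eq_bigr => I _; rewrite pair_wordsZ pair_words_codom.
Qed.

Lemma xpow_rel a p J : \sum_q c p q *: xpow r k (upd2 a q J) = 0.
Proof.
apply: val_inj; rewrite linear_sum /=.
transitivity (\pi_(quadAlg r)
    (word K (take a (codom J)) * r p * word K (drop a.+2 (codom J)))).
  rewrite word_relE pi_sum.
  by apply: eq_bigr => q _; rewrite piZr -codom_upd2 -grade_val_xpow.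
rewrite -[RHS]pi_zeror; apply/quadAlg_eqP; rewrite subr0.
apply/rel_idealP.
exists [:: (word K (take a (codom J)), p, word K (drop a.+2 (codom J)))].
by rewrite big_seq1.
Qed.

(** Converse of [pairing_eq0], responsible for injectivity of the pairing map. The conditions on [u]
    form a finite linear system, so this is a double annihilator argument. *)
Lemma xpow_eq0 (f : mindex n k -> K) :
  (forall u, satisfies_rel u -> \sum_I f I * u I = 0) ->
  \sum_I f I *: xpow r k I = 0.
Proof.
move=> hf; pose E : finType := ('I_k.-1 * ('I_n * 'I_n) * mindex n k)%type.
pose coef (e : E) (I : mindex n k) : K := \sum_q c e.1.2 q * (I == upd2 e.1.1 q e.2)%:R.
(* Stated for any module, since it serves both for the scalars [u] and for the components of
   [xpow]. *)
have coefE e (V : lmodType K) (v : mindex n k -> V) :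
    \sum_I coef e I *: v I = \sum_q c e.1.2 q *: v (upd2 e.1.1 q e.2).
  under eq_bigr do rewrite scaler_suml.
  rewrite exchange_big; apply: eq_bigr => q _ /=.
  rewrite (bigD1 (upd2 e.1.1 q e.2)) //= eqxx mulr1 big1 ?addr0 // => I.
  by move/negPf ->; rewrite mulr0 scale0r.
pose M := \matrix_(i < #|E|, j < #|{: mindex n k}|) coef (enum_val i) (enum_val j).
pose fv := \row_(j < #|{: mindex n k}|) f (enum_val j).
have sum_rank (g : mindex n k -> K) :
    \sum_(j < #|{: mindex n k}|) g (enum_val j) = \sum_I g I.
  by apply/esym/reindex/onW_bij/enum_val_bij.
(* The columns of [cokermx M] are the solutions u, so f annihilates them and is
   a combination of the rows of M, which are the relations. *)
have /submxP [D fD] : (fv <= M)%MS.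
  rewrite submxE; apply/eqP/rowP => j; rewrite !mxE.
  pose u I := cokermx M (enum_rank I) j.
  rewrite -[RHS](hf u).
    by rewrite -sum_rank; apply: eq_bigr => i _; rewrite mxE /u enum_valK.
  move=> a p J.
  have := congr1 (fun N : 'M_(_, _) => N (enum_rank (a, p, J)) j) (mulmx_coker M).
  rewrite /= !mxE => {2}<-; rewrite -(coefE (a, p, J) K^o u) -sum_rank.
  by apply: eq_bigr => i _; rewrite mxE /u enum_valK enum_rankK.
have fE I : f I = \sum_i D 0 i * coef (enum_val i) I.
  have := congr1 (fun N : 'M_(_, _) => N 0 (enum_rank I)) fD.
  rewrite /= !mxE enum_rankK => ->.
  by apply: eq_bigr => i _; rewrite mxE enum_rankK.
under eq_bigr do rewrite fE scaler_suml.
rewrite exchange_big big1 // => i _ /=.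
under eq_bigr do rewrite -scalerA.
by rewrite -scaler_sumr coefE xpow_rel scaler0.
Qed.

(** Apply [pairing_eq0] and [xpow_eq0] to the rows of [m] minus the identity. This turns the
    normalisation of an operator on the tensor power of the generators into a condition on
    solutions. *)
Lemma xpow_fixedP (m : mindex n k -> mindex n k -> K) :
  (forall I, \sum_J m I J *: xpow r k J = xpow r k I) <->
  (forall u, satisfies_rel u -> forall I, \sum_J m I J * u J = u I).
Proof.
have sub_id I (M : lmodType K) (x : mindex n k -> M) :
    \sum_J (m I J - (J == I)%:R) *: x J = \sum_J m I J *: x J - x I.
  under eq_bigr do rewrite scalerBl.
  rewrite sumrB; congr (_ - _); rewrite (bigD1 I) //= eqxx scale1r.
  by rewrite big1 ?addr0 // => J /negPf ->; rewrite scale0r.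
split=> [hm u hu I|hm I]; apply/eqP; rewrite -subr_eq0.
  rewrite -(sub_id I K^o u); apply/eqP.
  by apply: pairing_eq0 hu; rewrite sub_id hm subrr.
rewrite -sub_id; apply/eqP/xpow_eq0 => u hu.
by rewrite (sub_id I K^o u) hm // subrr.
Qed.

(** The space [U] parametrises the solutions through their coordinates [h]; keeping it abstract
    covers spaces of vectors and of covectors at once. *)
Lemma grade_pairing (U : vectType K) (h : 'Hom(U, tensor K n k)) :
    lker h == 0%VS -> (forall u : tensor K n k, satisfies_rel u <-> u \in limg h) ->
  exists phi : {linear grade r k -> 'Hom(U, K^o)}, bijective phi /\
    forall (f : mindex n k -> K) w,
      phi (\sum_I f I *: xpow r k I) w = \sum_I f I * h w I.
Proof.
move=> h_inj h_img.
have h_rel w : satisfies_rel (h w) by apply/h_img/memv_img/memvf.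
pose ev (f : mindex n k -> K) w : K^o := \sum_I f I * h w I.
have ev_linear f : linear (ev f).
  move=> a w w'; rewrite /ev scaler_sumr -big_split; apply: eq_bigr => I _ /=.
  by rewrite linearP !ffunE mulrDr mulrCA.
pose evL f : {linear U -> K^o} :=
  HB.pack (ev f) (GRing.isLinear.Build K U K^o *:%R (ev f) (ev_linear f)).
have evE f w : linfun (ev f) w = ev f w by exact: (lfunE (evL f)).
(* An arbitrary choice of coefficients; [ev_wd] shows that the resulting form does not depend on
   it. *)
pose coef (x : grade r k) : mindex n k -> K := projT1 (cid (xpow_span x)).
have coefE x : \sum_I coef x I *: xpow r k I = x := esym (projT2 (cid (xpow_span x))).
have ev_wd f g : \sum_I f I *: xpow r k I = \sum_I g I *: xpow r k I ->
    linfun (ev f) = linfun (ev g).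
  move=> fg; apply/lfunP => w; rewrite !evE; apply/eqP.
  rewrite -subr_eq0 -sumrB; apply/eqP.
  under eq_bigr do rewrite -mulrBl.
  apply: pairing_eq0 (h_rel w).
  by under eq_bigr do rewrite scalerBl; rewrite sumrB fg subrr.
pose phi x := linfun (ev (coef x)).
have phi_sum f : phi (\sum_I f I *: xpow r k I) = linfun (ev f).
  by apply: ev_wd; rewrite coefE.
have phi_linear : linear phi.
  move=> a x y.
  have -> : a *: x + y = \sum_I (a * coef x I + coef y I) *: xpow r k I.
    under eq_bigr do rewrite scalerDl -scalerA.
    by rewrite big_split -scaler_sumr !coefE.
  rewrite phi_sum; apply/lfunP => w; rewrite add_lfunE scale_lfunE !evE.
  rewrite /ev scaler_sumr -big_split; apply: eq_bigr => I _ /=.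
  by rewrite mulrDl -mulrA.
pose phiL : {linear grade r k -> 'Hom(U, K^o)} :=
  HB.pack phi (GRing.isLinear.Build K (grade r k) 'Hom(U, K^o) *:%R phi phi_linear).
exists phiL; split; last by move=> f w; rewrite [phiL _]phi_sum evE.
(* Every solution is some [h w], so an element of the kernel pairs to zero with all solutions and
   [xpow_eq0] applies. *)
have phi_eq0 x : phi x = 0 -> x = 0.
  move=> x0; rewrite -[x]coefE; apply: xpow_eq0 => u hu.
  have /h_img /memv_imgP [w _ uE] : satisfies_rel (finfun u : tensor K n k).
    move=> a p J; rewrite -[RHS](hu a p J).
    by apply: eq_bigr => q _; rewrite ffunE.
  have x0w : phi x w = 0 by rewrite x0 zero_lfunE.
  rewrite -[RHS]x0w evE.
  by apply: eq_bigr => I _; rewrite -uE ffunE.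
(* Composing with the left inverse of [h] extends [g] to all tensors; the values of this extension
   on the standard basis are the coefficients of a preimage. *)
pose psi (g : 'Hom(U, K^o)) :=
  \sum_I (g (h^-1%VF (ebasis K I)) : K) *: xpow r k I.
have phiK g : phi (psi g) = g.
  rewrite phi_sum; apply/lfunP => w; rewrite evE /ev.
  rewrite -[in RHS](lker0_lfunK h_inj w).
  rewrite {2}[h w]ebasis_sum !linear_sum; apply: eq_bigr => I _.
  by rewrite !linearZ /= mulrC.
exists psi => // x; apply/eqP; rewrite -subr_eq0; apply/eqP/phi_eq0.
by rewrite [phi _](linearB phiL) /= phiK subrr.
Qed.

End Presentation.

(** * Solutions of the relations as kernels of the operators [leg T a] *)

Section Legs.
Variables (K : fieldType) (n k : nat).
Implicit Types (T : 'End(tensor2 K n)) (a : 'I_k.-1) (I J : mindex n k).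

Lemma rpos_lpos a : (rpos a == lpos a) = false.
Proof. by rewrite -val_eqE /= gtn_eqF. Qed.

Lemma upd2_upd2 a p q I : upd2 a q (upd2 a p I) = upd2 a q I.
Proof. by apply/ffunP => d; rewrite !ffunE; case: (d == _); case: (d == _). Qed.

Lemma upd2_lpos a p I : upd2 a p I (lpos a) = p.1.
Proof. by rewrite ffunE eqxx. Qed.

Lemma upd2_rpos a p I : upd2 a p I (rpos a) = p.2.
Proof. by rewrite ffunE rpos_lpos eqxx. Qed.

Lemma upd2_id a I : upd2 a (I (lpos a), I (rpos a)) I = I.
Proof.
by apply/ffunP => d; rewrite ffunE; case: eqP => [->|_] //; case: eqP => [->|].
Qed.

(** Both sides say that [I] and [J] agree away from the two places of [a], where [J] carries [p].
    The right side exchanges the roles of [I] and [J], as passing from rows to columns requires. *)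
Lemma upd2_eq a p I J :
  (upd2 a p I == J) =
  (p == (J (lpos a), J (rpos a))) && (upd2 a (I (lpos a), I (rpos a)) J == I).
Proof.
apply/eqP/andP => [<-|[/eqP -> /eqP <-]]; last by rewrite upd2_upd2 upd2_id.
by rewrite upd2_lpos upd2_rpos upd2_upd2 upd2_id -surjective_pairing !eqxx.
Qed.

(** [leg_fun] describes [leg] by output coordinates; covectors need this description by images of
    basis vectors. *)
Lemma leg_ebasis T a I :
  leg T a (ebasis K I) =
  \sum_p entry T p (I (lpos a), I (rpos a)) *: ebasis K (upd2 a p I).
Proof.
rewrite lfunE; apply/ffunP => J; rewrite ffunE sum_ffunE.
rewrite (bigD1 (I (lpos a), I (rpos a))) //=.
rewrite [RHS](bigD1 (J (lpos a), J (rpos a))) //=.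
rewrite big1 => [|q /negPf neq]; last by rewrite ffunE upd2_eq neq scaler0.
rewrite big1 => [|q /negPf neq]; last by rewrite !ffunE eq_sym upd2_eq neq scaler0.
by rewrite !addr0 !ffunE upd2_eq eqxx /= [in RHS]eq_sym.
Qed.

Lemma satisfies_rel_ker T (u : tensor K n k) :
  satisfies_rel (entry T) u <-> u \in ker_legs k T.
Proof.
split=> [hu|/mem_ker_legs hu].
  apply/mem_ker_legs => a; apply/ffunP => I; rewrite lfunE !ffunE.
  exact: hu.
(* The relation [p] in the context [J] is the coordinate of [leg T a u] at [upd2 a p J]. *)
move=> a p J; have := congr1 (fun v : tensor K n k => v (upd2 a p J)) (hu a).
rewrite /= lfunE [LHS]ffunE [RHS]ffunE => h; rewrite -[RHS]h.
by apply: eq_bigr => q _; rewrite upd2_lpos upd2_rpos upd2_upd2 -surjective_pairing.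
Qed.

(** The coefficients are transposed because operators act on covectors from the right. *)
Lemma satisfies_rel_coker T (xi : covector K n k) :
  satisfies_rel (fun p q => entry T q p) (fun I => xi (ebasis K I)) <->
  xi \in coker_legs k T.
Proof.
have legE a I : (xi \o leg T a)%VF (ebasis K I) =
    \sum_p entry T p (I (lpos a), I (rpos a)) * (xi (ebasis K (upd2 a p I)) : K).
  rewrite comp_lfunE leg_ebasis linear_sum.
  by apply: eq_bigr => p _; rewrite linearZ.
split=> [hxi|/mem_coker_legs hxi].
  apply/mem_coker_legs => a; apply/lfunP => v.
  rewrite zero_lfunE covectorE big1 // => I _.
  by rewrite legE hxi mul0r.
move=> a p J; have := legE a (upd2 a p J); rewrite hxi zero_lfunE => h.
rewrite [RHS]h; apply: eq_bigr => q _.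
by rewrite upd2_lpos upd2_rpos upd2_upd2 -surjective_pairing.
Qed.

End Legs.

(** * Projectors and natural duality *)

Section Projector.
Variables (K : fieldType) (n k : nat) (T : 'End(tensor2 K n)).
Local Notation V := (ker_legs k T).
Local Notation V' := (coker_legs k T).

(* The conditions that a k-th operator imposes, once the algebras are dualised. *)
Definition dual_projector (P : 'End(tensor K n k)) : Prop :=
  [/\ forall a : 'I_k.-1, (leg T a \o P)%VF = 0 /\ (P \o leg T a)%VF = 0,
      forall xi, xi \in V' -> (xi \o P)%VF = xi &
      forall v, v \in V -> P v = v].

Lemma dual_projector_mem P v : dual_projector P -> P v \in V.
Proof.
case=> hP _ _; apply/mem_ker_legs => a.
by rewrite -comp_lfunE (hP a).1 zero_lfunE.
Qed.

Lemma sum_rank1E (d : nat) (v : d.-tuple (tensor K n k))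
    (v' : d.-tuple (covector K n k)) w :
  (\sum_(al < d) rank1 (tnth v al) (tnth v' al)) w =
  \sum_(al < d) (tnth v' al w : K) *: tnth v al.
Proof. by rewrite sum_lfunE; apply: eq_bigr => al _; rewrite rank1E. Qed.

Lemma dual_basesE (d : nat) (v : d.-tuple (tensor K n k))
    (v' : d.-tuple (covector K n k)) w :
  dual_bases V V' v v' -> w \in V ->
  w = \sum_(al < d) (tnth v' al w : K) *: tnth v al.
Proof.
case=> [bv _ dv] wV; rewrite {1}(coord_basis bv wV).
apply: eq_bigr => al _; rewrite (tnth_nth 0 v); congr (_ *: _).
rewrite {2}(coord_basis bv wV) linear_sum (bigD1 al) //=.
rewrite linearZ /= -(tnth_nth 0 v) dv eqxx big1 => [|be nebe].
  by rewrite addr0 [RHS]mulr1.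
by rewrite linearZ /= -(tnth_nth 0 v) dv eq_sym (negPf nebe) scaler0.
Qed.

(** [P w] lies in [V], so it expands in [v] with coefficients [v'] evaluated at [P w]; these equal
    [v'] evaluated at [w], since [P] fixes the covectors of [V']. *)
Lemma dual_projectorE P (d : nat) (v : d.-tuple (tensor K n k))
    (v' : d.-tuple (covector K n k)) :
  dual_projector P -> dual_bases V V' v v' ->
  P = \sum_(al < d) rank1 (tnth v al) (tnth v' al).
Proof.
move=> hP hv; apply/lfunP => w; rewrite sum_rank1E.
rewrite (dual_basesE hv (dual_projector_mem w hP)); apply: eq_bigr => al _.
case: hP hv => _ hP' _ [_ bv' _].
by rewrite -[in RHS](hP' (tnth v' al)) ?comp_lfunE // (basis_mem bv') // mem_tnth.
Qed.

Lemma dual_projector_exists :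
  (exists P, dual_projector P) <-> naturally_dual V V'.
Proof.
split=> [[P hP]|[_ [d [v [v' hv]]]]].
  have PV w := dual_projector_mem w hP.
  have [hPT hP' hPv] := hP.
  pose v := vbasis V.
  have bv : basis_of V v := vbasisP V.
  (* Since [P] maps into [V], only the values of the coordinate forms on [V] matter. These covectors
     lie in [V'] because [P] kills the images of the legs, and they span it because each [xi] in
     [V'] factors through [P]. *)
  pose v' : (\dim V).-tuple (covector K n k) :=
    [tuple (linfun (coord v al : tensor K n k -> K^o) \o P)%VF | al < \dim V].
  have v'E al w : tnth v' al w = coord v al (P w).
    by rewrite tnth_mktuple comp_lfunE lfunE.
  have dv al be : tnth v' al (tnth v be) = (al == be)%:R.
    rewrite v'E hPv ?(basis_mem bv) ?mem_tnth // (tnth_nth 0).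
    by rewrite coord_free ?(basis_free bv) // eq_sym.
  have v'V' al : tnth v' al \in V'.
    apply/mem_coker_legs => a; rewrite tnth_mktuple -comp_lfunA (hPT a).2.
    exact: comp_lfun0r.
  have V'E xi : xi \in V' -> xi = \sum_(al < \dim V) (xi (tnth v al) : K) *: tnth v' al.
    move=> xiV'; apply/lfunP => w; rewrite -{1}(hP' _ xiV') comp_lfunE.
    rewrite (coord_basis bv (PV w)) linear_sum sum_lfunE.
    apply: eq_bigr => al _; rewrite linearZ /= scale_lfunE v'E -(tnth_nth 0 v).
    by rewrite [LHS]mulrC.
  have bv' : basis_of V' v'.
    apply/andP; split; last first.
      apply/freeP => f f0 be.
      have := congr1 (fun xi : covector K n k => xi (tnth v be)) f0.
      rewrite zero_lfunE sum_lfunE (bigD1 be) //= scale_lfunE -(tnth_nth 0 v') dv eqxx.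
      rewrite big1 => [|al neal]; first by rewrite addr0 [_ *: _]mulr1.
      by rewrite scale_lfunE -(tnth_nth 0 v') dv (negPf neal) scaler0.
    rewrite eqEsubv; apply/andP; split.
      by apply/span_subvP => xi /tnthP [al ->].
    apply/subvP => xi /V'E ->; apply: memv_suml => al _.
    by apply/memvZ/memv_span/mem_tnth.
  by split; [rewrite -(size_basis bv') | exists (\dim V), v, v'].
exists (\sum_(al < d) rank1 (tnth v al) (tnth v' al)).
have [bv bv' dv] := hv.
have vV al : tnth v al \in V by rewrite (basis_mem bv) ?mem_tnth.
have v'V' al : tnth v' al \in V' by rewrite (basis_mem bv') ?mem_tnth.
split=> [a|xi xiV'|w wV].
- split; apply/lfunP => w; rewrite comp_lfunE sum_rank1E zero_lfunE.
    rewrite linear_sum big1 // => al _; rewrite linearZ /=.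
    by have /mem_ker_legs -> := vV al; rewrite scaler0.
  rewrite big1 // => al _; rewrite -comp_lfunE.
  by have /mem_coker_legs -> := v'V' al; rewrite zero_lfunE scale0r.
(* By linearity it is enough to treat the members of [v'], for which duality leaves a single term of
   the sum. *)
- rewrite (coord_basis bv' xiV'); apply/lfunP => w.
  rewrite comp_lfunE !sum_lfunE; apply: eq_bigr => al _.
  rewrite !scale_lfunE -(tnth_nth 0 v'); congr (_ *: _).
  rewrite -sum_lfunE sum_rank1E linear_sum (bigD1 al) //= linearZ /= dv eqxx.
  rewrite big1 => [|be nebe]; first by rewrite addr0 [LHS]mulr1.
  by rewrite linearZ /= dv eq_sym (negPf nebe) scaler0.
- by rewrite sum_rank1E -(dual_basesE hv wV).
Qed.

End Projector.

(** * The two algebras attached to the rows and to the columns of [T] *)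

Section QuadraticDual.
Variables (K : fieldType) (n k : nat) (T : 'End(tensor2 K n)).
Variables r r' : quadRel K n.
Hypothesis rE : forall p, r p = \sum_q entry T p q *: (gen K q.1 * gen K q.2).
Hypothesis r'E : forall p, r' p = \sum_q entry T q p *: (gen K q.1 * gen K q.2).
Local Notation V := (ker_legs k T).
Local Notation V' := (coker_legs k T).

(** Used with [T] equal to [A] for the generators [x^i], and with [T] equal to [1 - A] for the
    generators [psi^i]. *)
Lemma grade_ker_legs :
  exists phi : {linear grade r k -> 'Hom(subvs_of V, K^o)}, bijective phi /\
    forall (xi : covector K n k) (v : subvs_of V),
      phi (covec_app xi (xpow r k)) v = xi (vsval v).
Proof.
pose h : 'Hom(subvs_of V, tensor K n k) := linfun vsval.
have h_inj : lker h == 0%VS by apply/lker0P => v w; rewrite !lfunE => /val_inj.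
have h_img (u : tensor K n k) : satisfies_rel (entry T) u <-> u \in limg h.
  split=> [/satisfies_rel_ker uV|/memv_imgP [v _ ->]].
    by apply/memv_imgP; exists (Subvs uV); rewrite ?memvf ?lfunE.
  by apply/satisfies_rel_ker; rewrite lfunE subvsP.
have [phi [phi_bij phiE]] := grade_pairing rE h_inj h_img.
exists phi; split=> // xi v; rewrite [LHS]phiE [RHS]covectorE.
by apply: eq_bigr => I _; rewrite lfunE.
Qed.

(** A covector is encoded by its values on the standard basis, which makes the space of solutions a
    space of tensors and brings the claim under [grade_pairing]. *)
Lemma grade_coker_legs :
  exists phi : {linear grade r' k -> 'Hom(subvs_of V', K^o)}, bijective phi /\
    forall (v : tensor K n k) (xi : subvs_of V'),
      phi (vec_app (xpow r' k) v) xi = vsval xi v.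
Proof.
pose coord_fun (xi : subvs_of V') : tensor K n k := [ffun I => vsval xi (ebasis K I)].
have coord_linear : linear coord_fun.
  by move=> a xi zeta; apply/ffunP => I; rewrite !ffunE linearP add_lfunE scale_lfunE.
pose coordL : {linear subvs_of V' -> tensor K n k} :=
  HB.pack coord_fun (GRing.isLinear.Build K _ _ *:%R coord_fun coord_linear).
pose h : 'Hom(subvs_of V', tensor K n k) := linfun coord_fun.
have hE xi I : h xi I = vsval xi (ebasis K I).
  by rewrite [h xi](lfunE coordL) ffunE.
have h_inj : lker h == 0%VS.
  apply/lker0P => xi zeta eqh; apply/val_inj/lfunP => v.
  by rewrite /= !(covectorE _ v); apply: eq_bigr => I _; rewrite -!hE eqh.
have h_img (u : tensor K n k) :
    satisfies_rel (fun p q => entry T q p) u <-> u \in limg h.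
  split=> [hu|/memv_imgP [xi _ ->]]; last first.
    move=> a p J; have /satisfies_rel_coker hxi := subvsP xi.
    by rewrite -[RHS](hxi a p J); apply: eq_bigr => q _; rewrite hE.
  have [xi xiE] := covector_of_coords u.
  have xiV' : xi \in V'.
    apply/satisfies_rel_coker => a p J; rewrite -[RHS](hu a p J).
    by apply: eq_bigr => q _; rewrite xiE.
  apply/memv_imgP; exists (Subvs xiV'); first exact: memvf.
  by apply/ffunP => I; rewrite hE /= xiE.
have [phi [phi_bij phiE]] := grade_pairing r'E h_inj h_img.
exists phi; split=> // v xi; rewrite [LHS]phiE [RHS]covectorE.
by apply: eq_bigr => I _; rewrite hE mulrC.
Qed.

(** This is [xpow_fixedP] for the matrix of [P]; [ract_xpow] uses the transposed matrix. *)
Lemma lact_xpow (P : 'End(tensor K n k)) :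
  lact P (xpow r k) = xpow r k <-> forall v, v \in V -> P v = v.
Proof.
split=> [hP v /satisfies_rel_ker hv|hP]; apply/ffunP => I.
  rewrite end_entryE; apply: (iffLR (xpow_fixedP rE (entry P))) _ v hv I => J.
  by rewrite -[in RHS]hP ffunE.
rewrite ffunE; move: I; apply/(xpow_fixedP rE (entry P)) => u hu I.
have uV : finfun u \in V.
  apply/satisfies_rel_ker => a p J; rewrite -[RHS](hu a p J).
  by apply: eq_bigr => q _; rewrite ffunE.
rewrite -[u I]ffunE -[in RHS](hP _ uV) end_entryE.
by apply: eq_bigr => J _; rewrite ffunE.
Qed.

Lemma ract_xpow (P : 'End(tensor K n k)) :
  ract (xpow r' k) P = xpow r' k <-> forall xi, xi \in V' -> (xi \o P)%VF = xi.
Proof.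
have compE (xi : covector K n k) J :
    (xi \o P)%VF (ebasis K J) = \sum_I entry P I J * (xi (ebasis K I) : K).
  rewrite comp_lfunE covectorE; apply: eq_bigr => I _.
  by rewrite [LHS]mulrC.
split=> [hP xi /satisfies_rel_coker hxi|hP].
  apply/lfunP => v; rewrite !(covectorE _ v); apply: eq_bigr => J _; congr (_ * _).
  rewrite compE.
  apply: (iffLR (xpow_fixedP r'E (fun J I => entry P I J))) _ _ hxi J => I.
  by rewrite -[in RHS]hP ffunE.
apply/ffunP => J; rewrite ffunE; move: J.
apply/(xpow_fixedP r'E (fun J I => entry P I J)) => u hu J.
have [xi xiE] := covector_of_coords u.
have xiV' : xi \in V'.
  apply/satisfies_rel_coker => a p I; rewrite -[RHS](hu a p I).
  by apply: eq_bigr => q _; rewrite xiE.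
rewrite -xiE -[in RHS](hP _ xiV') compE.
by apply: eq_bigr => I _; rewrite xiE.
Qed.

Lemma dual_projectorP (P : 'End(tensor K n k)) :
  dual_projector T P <->
  [/\ forall a : 'I_k.-1, (leg T a \o P)%VF = 0 /\ (P \o leg T a)%VF = 0,
      ract (xpow r' k) P = xpow r' k & lact P (xpow r k) = xpow r k].
Proof.
split=> [] [hP h1 h2]; split=> //;
  by [apply/ract_xpow | apply/lact_xpow | exact/ract_xpow | exact/lact_xpow].
Qed.

(** The predicate is a parameter so that [is_S_operator A] and [is_A_operator A] both fit, with [T]
    equal to [A] and to [1 - A]. *)
Lemma operator_iff_naturally_dual (is_op : 'End(tensor K n k) -> Prop) :
  (forall P, is_op P <->
     [/\ forall a : 'I_k.-1, (leg T a \o P)%VF = 0 /\ (P \o leg T a)%VF = 0,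
         ract (xpow r' k) P = xpow r' k & lact P (xpow r k) = xpow r k]) ->
  ((exists P, is_op P) <-> naturally_dual V V') /\
  (forall P (d : nat) (v : d.-tuple (tensor K n k)) (v' : d.-tuple (covector K n k)),
     is_op P -> dual_bases V V' v v' ->
     P = \sum_(al < d) rank1 (tnth v al) (tnth v' al)).
Proof.
move=> opP; have opE P : is_op P <-> dual_projector T P.
  by rewrite opP dual_projectorP.
split=> [|P d v v' /opE]; last exact: dual_projectorE.
by rewrite -dual_projector_exists; split=> -[P /opE hP]; exists P.
Qed.

End QuadraticDual.

(** * The relations of the [psi] algebras in terms of [1 - A] *)

Section Relations.
Variables (K : fieldType) (n : nat) (A : 'End(tensor2 K n)).

Lemma entry_1B p q : entry (\1 - A)%VF p q = (p == q)%:R - entry A p q.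
Proof. by rewrite /entry add_lfunE opp_lfunE id_lfunE !ffunE. Qed.

(** Moving everything to one side makes the [psi] relations those of type [x] for [1 - A], so no
    separate treatment is needed. *)
Lemma Psi_relE p :
  Psi_rel A p = \sum_q entry (\1 - A)%VF q p *: (gen K q.1 * gen K q.2).
Proof.
under eq_bigr do rewrite entry_1B scalerBl.
rewrite sumrB; congr (_ - _); rewrite (bigD1 p) //= eqxx scale1r.
by rewrite big1 ?addr0 // => q /negPf ->; rewrite scale0r.
Qed.

Lemma Psis_relE p :
  Psis_rel A p = \sum_q entry (\1 - A)%VF p q *: (gen K q.1 * gen K q.2).
Proof.
under eq_bigr do rewrite entry_1B scalerBl.
rewrite sumrB; congr (_ - _); rewrite (bigD1 p) //= eqxx scale1r.
by rewrite big1 ?addr0 // => q /negPf; rewrite eq_sym => ->; rewrite scale0r.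
Qed.

End Relations.

Theorem theorem5p12 (R : realType) (n k : nat)
    (A : 'End(tensor2 R[i] n)) (hA : (A \o A)%VF = A) (hk : (2 <= k)%N) :
  (* pairings *)
  [/\ exists phi : {linear grade (X_rel A) k -> 'Hom(subvs_of (Vsp A k), R[i]^o)},
        bijective phi /\
        forall (xi : covector R[i] n k) (v : subvs_of (Vsp A k)),
          phi (covec_app xi (Xpow A k)) v = xi (vsval v),
      exists phi : {linear grade (Xs_rel A) k -> 'Hom(subvs_of (Vbarsp A k), R[i]^o)},
        bijective phi /\
        forall (v : tensor R[i] n k) (xi : subvs_of (Vbarsp A k)),
          phi (vec_app (Xspow A k) v) xi = vsval xi v,
      exists phi : {linear grade (Psi_rel A) k -> 'Hom(subvs_of (Wbarsp A k), R[i]^o)},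
        bijective phi /\
        forall (v : tensor R[i] n k) (xi : subvs_of (Wbarsp A k)),
          phi (vec_app (Psipow A k) v) xi = vsval xi v &
      exists phi : {linear grade (Psis_rel A) k -> 'Hom(subvs_of (Wsp A k), R[i]^o)},
        bijective phi /\
        forall (xi : covector R[i] n k) (v : subvs_of (Wsp A k)),
          phi (covec_app xi (Psispow A k)) v = xi (vsval v)]
  /\
  (* (1) *)
  (((exists Sk : 'End(tensor R[i] n k), is_S_operator A Sk) <->
      naturally_dual (Vsp A k) (Vbarsp A k)) /\
   (forall (Sk : 'End(tensor R[i] n k)) (d : nat)
      (v : d.-tuple (tensor R[i] n k)) (v' : d.-tuple (covector R[i] n k)),
      is_S_operator A Sk -> dual_bases (Vsp A k) (Vbarsp A k) v v' ->
      Sk = \sum_(al < d) rank1 (tnth v al) (tnth v' al)))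
  /\
  (* (2) *)
  (((exists Ak : 'End(tensor R[i] n k), is_A_operator A Ak) <->
      naturally_dual (Wsp A k) (Wbarsp A k)) /\
   (forall (Ak : 'End(tensor R[i] n k)) (d : nat)
      (w : d.-tuple (tensor R[i] n k)) (w' : d.-tuple (covector R[i] n k)),
      is_A_operator A Ak -> dual_bases (Wsp A k) (Wbarsp A k) w w' ->
      Ak = \sum_(al < d) rank1 (tnth w al) (tnth w' al))).
Proof.
split; [split | split].
- exact: (@grade_ker_legs _ _ _ A).
- exact: (@grade_coker_legs _ _ _ A).
- exact/grade_coker_legs/Psi_relE.
- exact/grade_ker_legs/Psis_relE.
- exact: (@operator_iff_naturally_dual _ _ _ A (X_rel A) (Xs_rel A)).
(* [Psis_rel] comes first: its relations are the rows of [1 - A], hence dual to vectors, while those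
   of [Psi_rel] are the columns. *)
- exact: (operator_iff_naturally_dual (Psis_relE A) (Psi_relE A)).
Qed.
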